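(* Let $r>s\ge 1$ be fixed integers and let $p=p(n)=\omega\left(n^{-\frac{r-s}{2}}\right)$. Then almost surely $$\liminf_{n\to\infty}q^*(G_p(n,r,s))\ge\frac{s}{2r-s}\left(1+\left(\frac{r-s}{r}\right)^{\frac{2r}{s}}\right).$$
   Context: For integers $n,r,s$, the Johnson graph $G(n,r,s)$ has as vertices all vectors $v\in\{0,1\}^n$ with exactly $r$ ones; two vertices are joined by an edge if and only if their inner product equals $s$. For $p\in[0,1]$, $G_p(n,r,s)$ is the random graph obtained from $G(n,r,s)$ by removing every edge with probability $1-p$ independently of all other edges. The random graphs of the sequence are regarded as defined on a common probability space. Modularity: for a graph $G$ with $e(G)$ edges and a partition $\mathcal{A}$ of its vertex set, $q(\mathcal{A})=\sum_{A\in\mathcal{A}}\frac{e(A)}{e(G)}-\sum_{A\in\mathcal{A}}\frac{(\sum_{v\in A}\deg(v))^2}{4e(G)^2}$, where $e(A)$ is the number of edges of $G$ with both endpoints in $A$. The modularity of $G$ is $q^*(G)=\max_{\mathcal{A}}q(\mathcal{A})$, over all partitions of the vertex set. $f=\omega(g)$ means $f(n)/g(n)\to\infty$ as $n\to\infty$. *)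

(* Defs.v *)
From HB Require Import structures.
From mathcomp Require Import all_boot all_order all_algebra.
From mathcomp Require Import all_classical all_reals all_analysis.
Set Implicit Arguments.
Unset Strict Implicit.
Unset Printing Implicit Defensive.
Import Order.TTheory GRing.Theory Num.Theory.
Import numFieldNormedType.Exports.
Local Open Scope ring_scope.

(* A simple graph on a finite vertex type V is given by its set of edges
   E : {set {set V}}, an edge being the two-element set of its endpoints. *)

Section Modularity.
Context (R : realType) {V : finType}.
Implicit Types (E : {set {set V}}) (A : {set V}) (PA : {set {set V}}).

Definition edges_within E A : {set {set V}} := [set e in E | e \subset A]%SET.

Definition degree E (v : V) : nat := #|[set e in E | v \in e]%SET|.

(* On a graph without edges this is 0, since x / 0 = 0. *)
Definition modularity_of E PA : R :=
  \sum_(A in PA) #|edges_within E A|%:R / #|E|%:R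
  - \sum_(A in PA)
      ((\sum_(v in A) degree E v)%N%:R ^+ 2 / (4 * #|E|%:R ^+ 2)).

Definition singletons : {set {set V}} := [set [set v]%SET | v in V]%SET.

(* The maximum is started at the value of the partition into singletons, which
   is among the competing partitions; see modularityP. *)
Definition modularity E : R :=
  \big[Num.max/modularity_of E singletons]_(PA : {set {set V}}
     | finset.partition PA [set: V]%SET) modularity_of E PA.

Lemma partition_singletons : finset.partition singletons [set: V]%SET.
Proof.
apply/and3P; split.
- rewrite finset.eqEsubset finset.subsetT /=; apply/fintype.subsetP => v _.
  by apply/finset.bigcupP; exists [set v]%SET; rewrite ?inE //; apply/imsetP; exists v.
- apply/finset.trivIsetP => A B /imsetP[u _ ->] /imsetP[v _ ->] uv.
  rewrite disjoints1 inE; apply: contra uv => /eqP ->; exact: eqxx.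
- apply/negP => /imsetP[v _ /setP/(_ v)]; by rewrite !inE eqxx.
Qed.

Lemma modularityP E :
  (exists2 PA, finset.partition PA [set: V]%SET
             & modularity E = modularity_of E PA) /\
  (forall PA, finset.partition PA [set: V]%SET ->
     modularity_of E PA <= modularity E).
Proof.
split; last by move=> PA ?; exact: le_bigmax_cond.
apply: (big_ind (fun x => exists2 PA, finset.partition PA [set: V]%SET
                                    & x = modularity_of E PA)).
- by exists singletons => //; exact: partition_singletons.
- move=> x y [A hA xA] [B hB yB]; rewrite maxEle.
  by case: ifP => _; [exists B | exists A].
- by move=> PA hPA; exists PA.
Qed.

End Modularity.

Section Johnson.
Variables n r s : nat.

Definition johnson_vertex : finType :=
  {v : {ffun 'I_n -> bool} | (\sum_(i < n) v i)%N == r}.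

Definition inner (u v : johnson_vertex) : nat :=
  (\sum_(i < n) val u i * val v i)%N.

Definition johnson : {set {set johnson_vertex}} :=
  [set e | [exists u, exists v,
     [&& u != v, inner u v == s & e == [set u; v]%SET]]]%SET.

End Johnson.

Section RandomSubgraph.
Context {d : measure_display} {T : measurableType d} {R : realType}.
Variable P : probability T R.

Definition mutually_independent (I : finType) (D : {set I})
    (F : I -> set T) : Prop :=
  (forall i, i \in D -> measurable (F i)) /\
  (forall J : {set I}, J \subset D ->
     P (\bigcap_(i in [set` J]) F i)%classic = (\prod_(i in J) P (F i))%E).

(* H is obtained from the graph E by removing every edge with probability
   1 - p, independently of all other edges. *)
Definition random_subgraph (V : finType) (E : {set {set V}}) (p : R)
    (H : T -> {set {set V}}) : Prop :=
  let removed e := [set w | e \notin H w]%classic in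
  [/\ forall w, H w \subset E,
      forall e, e \in E -> P (removed e) = (1 - p)%:E
    & mutually_independent E removed].

End RandomSubgraph.

Definition little_omega {R : realType} (f g : nat -> R) : Prop :=
  (f n / g n @[n --> \oo] --> +oo)%classic.

(* Main.v *)
(* Fix y in [0, 1].  Partition the r-sets according to their least element if it
   lies among the first n - yn coordinates, and put the r-sets avoiding these
   coordinates into one last part B.  The least element of u :|: v, for an edge
   {u, v}, is a uniform element of a set of size 2r - s, and it lies in u :&: v
   for a proportion s / (2r - s) of the edges.  Hence the parts contain in the
   limit a proportion s / (2r - s) + (1 - s / (2r - s)) y^(2r - s) of the edges,
   while only B has a non-vanishing proportion of the degrees, namely y^r.  The
   difference s / (2r - s) + (1 - s / (2r - s)) y^(2r - s) - y^(2r) is maximal at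
   y^s = (r - s) / r, where it is the claimed bound.

   In the random subgraph all relevant edge counts are sums over the edges of
   independent terms; the sum of their squared relative deviations has mean at
   most 9 / (p e(G)) = O(n^-2).  These means are summable, so the deviations
   tend to 0 almost surely. *)

Require Import Defs.
From mathcomp Require Import all_boot all_order all_algebra.
From mathcomp Require Import all_classical all_reals all_analysis.
From mathcomp Require Import measurable_realfun ring lra zify.
Set Implicit Arguments.
Unset Strict Implicit.
Unset Printing Implicit Defensive.
Import Order.TTheory GRing.Theory Num.Theory.
Import numFieldNormedType.Exports.
Local Open Scope ring_scope.

(** * Edge counts in Johnson graphs *)

Section SetCounting.
Variable T : finType.
Implicit Types (A B C Y Z : {set T}).

(** Such an [A] is determined by its traces on [Y] and [Z], which are an arbitrary [a]-subset and an
    arbitrary [b]-subset. *)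
Lemma card_draws_between C Y Z a b :
  [disjoint C & Y] -> [disjoint C & Z] -> [disjoint Y & Z] ->
  #|[set A : {set T} | [&& C \subset A, A \subset C :|: Y :|: Z,
       #|A :&: Y| == a & #|A :&: Z| == b]]%SET| = ('C(#|Y|, a) * 'C(#|Z|, b))%N.
Proof.
move=> dCY dCZ dYZ.
rewrite -!cards_draws -cardsX.
set D := finset.setX _ _.
have hD u : u \in D -> [/\ u.1 \subset Y, #|u.1| = a, u.2 \subset Z & #|u.2| = b].
  by rewrite !inE => /andP[/andP[? /eqP ?] /andP[? /eqP ?]].
have IY u : u \in D -> ((C :|: u.1 :|: u.2) :&: Y)%SET = u.1.
  case/hD => h1 _ h2 _; rewrite !finset.setIUl.
  rewrite (finset.disjoint_setI0 dCY) finset.set0U (finset.setIidPl h1).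
  have /finset.disjoint_setI0 -> : [disjoint u.2 & Y].
    by rewrite disjoint_sym; apply: disjointWr dYZ.
  by rewrite finset.setU0.
have IZ u : u \in D -> ((C :|: u.1 :|: u.2) :&: Z)%SET = u.2.
  case/hD => h1 _ h2 _; rewrite !finset.setIUl.
  rewrite (finset.disjoint_setI0 dCZ) finset.set0U (finset.setIidPl h2).
  have /finset.disjoint_setI0 -> : [disjoint u.1 & Z] by apply: disjointWl dYZ.
  by rewrite finset.set0U.
rewrite -(@card_in_imset _ _ (fun u : {set T} * {set T} => (C :|: u.1 :|: u.2)%SET) D).
- apply: eq_card => A; rewrite inE; apply/idP/imsetP.
  + case/and4P => CA sA /eqP ha /eqP hb; exists ((A :&: Y)%SET, (A :&: Z)%SET).
      by rewrite !inE /= ha hb !eqxx !finset.subsetIr.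
    apply/setP => x /=; rewrite !inE.
    have := fintype.subsetP CA x; have := fintype.subsetP sA x; rewrite !inE.
    by case: (x \in A); case: (x \in C); case: (x \in Y); case: (x \in Z) => //= h1 h2;
      (by have := h1 isT) || (by have := h2 isT).
  + case=> u uD ->; rewrite IY // IZ //; case: (hD _ uD) => h1 -> h2 ->; rewrite !eqxx !andbT.
    by rewrite -finset.setUA finset.subsetUl /= finset.setUA !finset.setUSS.
- move=> u v uD vD /= e; apply: injective_projections.
    by rewrite -(IY u) // -(IY v) // e.
  by rewrite -(IZ u) // -(IZ v) // e.
Qed.

End SetCounting.

(** * Double counting in a graph given by an adjacency relation *)

Section GraphSums.
Variables (V : finType) (adj : rel V).
Hypotheses (adj_sym : symmetric adj) (adj_irr : irreflexive adj).
Implicit Types (S E : {set {set V}}) (A : {set V}).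

Definition adj_edges : {set {set V}} :=
  [set e | [exists u, exists v, adj u v && (e == [set u; v]%SET)]]%SET.

Lemma card_adj_edge e : e \in adj_edges -> #|e| = 2.
Proof.
rewrite inE => /existsP[u /existsP[v /andP[uv /eqP ->]]].
rewrite cards2; case: eqP uv => // ->; by rewrite adj_irr.
Qed.

Lemma sum_degree S A :
  (\sum_(v in A) degree S v = \sum_(e in S) #|e :&: A|%SET)%N.
Proof.
rewrite (eq_bigr (fun v => \sum_(e in S | v \in e) 1)%N); last first.
  by move=> v _; rewrite /degree -sum1_card; apply: eq_bigl => e; rewrite inE.
rewrite (exchange_big_dep (mem S)) /=; last by move=> v e _ /andP[].
apply: eq_bigr => e eS; rewrite -sum1_card; apply: eq_bigl => v.
by rewrite inE eS andbC.
Qed.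

Lemma degree_edges_within A v : v \in A ->
  degree (edges_within adj_edges A) v = #|[set u in A | adj u v]%SET|.
Proof.
move=> vA.
have inj : {in [set u in A | adj u v]%SET &, injective (fun u => [set u; v]%SET)}.
  move=> u u'; rewrite !inE => /andP[_ uv] /andP[_ uv'] /setP/(_ u).
  rewrite !inE eqxx /= => /esym/orP[/eqP//|/eqP uev].
  by rewrite uev adj_irr in uv.
rewrite /degree -(card_in_imset inj); apply: eq_card => e; rewrite !inE.
apply/andP/imsetP.
- case=> /andP[/existsP[x /existsP[y /andP[xy /eqP ->]]]].
  rewrite finset.subUset !finset.sub1set => /andP[xA yA]; rewrite !inE.
  case/orP => /eqP ->; last by exists x => //; rewrite inE xA.
  by exists y; rewrite ?inE ?yA 1?adj_sym // finset.setUC.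
- case=> u; rewrite inE => /andP[uA uv] ->; split; last by rewrite !inE eqxx orbT.
  apply/andP; split; last by rewrite finset.subUset !finset.sub1set uA.
  by apply/existsP; exists u; apply/existsP; exists v; rewrite uv eqxx.
Qed.

(** The handshake identity in the subgraph induced on [A]: an edge within [A] meets [A] in both of
    its endpoints. *)
Lemma sum_card_neighbours A :
  (\sum_(v in A) #|[set u in A | adj u v]%SET| = 2 * #|edges_within adj_edges A|)%N.
Proof.
transitivity (\sum_(e in edges_within adj_edges A) #|e :&: A|%SET)%N.
  by rewrite -sum_degree; apply: eq_bigr => v /degree_edges_within ->.
rewrite mulnC -sum_nat_const; apply: eq_bigr => e.
by rewrite inE => /andP[/card_adj_edge he eA]; rewrite (finset.setIidPl eA).
Qed.

Lemma edges_withinT S : edges_within S [set: V]%SET = S.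
Proof. by apply/setP => e; rewrite !inE finset.subsetT andbT. Qed.

End GraphSums.

Lemma big_option (M : nmodType) (I : finType) (F : option I -> M) :
  \sum_i F i = F None + \sum_i F (Some i).
Proof.
rewrite (bigD1 None) //=; congr (_ + _).
rewrite (reindex_omap Some id); last by case.
by apply: eq_bigl => i; rewrite eqxx.
Qed.

Lemma disjoint_set0 (T : finType) (A : {set T}) : [disjoint finset.set0 & A].
Proof. by rewrite -finset.setI_eq0 finset.set0I. Qed.

(** * Modularity of the partition into the fibres of a labelling *)

Section Fibres.
Variables (R : realType) (V I : finType) (L : V -> I).
Implicit Types (S : {set {set V}}) (A : {set V}).

Definition fibre i : {set V} := [set v | L v == i]%SET.

(** A partition has no empty part, whereas a fibre may be empty. As [F] vanishes on the empty set,
    the sum may run over all labels. *)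
Lemma sum_preim_partition (M : nmodType) (F : {set V} -> M) : F (finset.set0 : {set V}) = 0 ->
  \sum_(A in preim_partition L [set: V]%SET) F A = \sum_i F (fibre i).
Proof.
move=> F0; rewrite [RHS](bigID (fun i => fibre i == finset.set0)) /=.
rewrite [X in _ = X + _]big1 ?add0r; last by move=> i /eqP ->.
have -> : preim_partition L [set: V]%SET =
    (fibre @: [set i | fibre i != finset.set0])%SET.
  apply/setP => A; apply/imsetP/imsetP.
  - case=> v _ ->; exists (L v).
      by rewrite inE; apply/finset.set0Pn; exists v; rewrite inE.
    by apply/setP => u; rewrite !inE eq_sym.
  - case=> i; rewrite inE => /finset.set0Pn[v]; rewrite inE => /eqP vi ->.
    by exists v => //; apply/setP => u; rewrite !inE eq_sym vi.
rewrite big_imset; last first.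
  move=> i j; rewrite !inE => /finset.set0Pn[v vi] _ e.
  move: (vi); rewrite e; move: vi; rewrite !inE => /eqP <- /eqP <- //.
by apply: eq_bigl => i; rewrite inE.
Qed.

(** All counts entering the modularity are sums of this kind, so a single variance computation
    covers them. *)
Definition wsum (f : {set V} -> R) S : R := \sum_(e in S) f e.

Definition inner_part (e : {set V}) : R := \sum_i (e \subset fibre i)%:R.

Lemma wsum1 S : wsum (fun=> 1) S = #|S|%:R.
Proof. by rewrite /wsum sumr_const. Qed.

Lemma wsum_inner_part S :
  wsum inner_part S = (\sum_i #|edges_within S (fibre i)|)%N%:R.
Proof.
rewrite natr_sum /wsum /inner_part exchange_big /=; apply: eq_bigr => i _.
rewrite -sum1_card natr_sum big_mkcond [RHS]big_mkcond /=; apply: eq_bigr => e _.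
by rewrite inE; case: (e \in S); case: (e \subset _).
Qed.

(** The hypothesis excludes the empty edge, which alone could lie within an empty fibre. *)
Lemma modularity_of_fibres S : finset.set0 \notin S ->
  modularity_of R S (preim_partition L [set: V]%SET) =
  wsum inner_part S / wsum (fun=> 1) S
  - \sum_i (wsum (fun e => #|e :&: fibre i|%SET%:R) S) ^+ 2
      / (4 * wsum (fun=> 1) S ^+ 2).
Proof.
move=> S0; rewrite /modularity_of wsum1; congr (_ - _); last first.
  rewrite sum_preim_partition; last by rewrite big_set0 expr0n /= mul0r.
  by apply: eq_bigr => i _; rewrite sum_degree natr_sum.
rewrite sum_preim_partition; last first.
  suff -> : edges_within S finset.set0 = finset.set0 by rewrite cards0 mul0r.
  apply/setP => e; rewrite !inE finset.subset0; apply/andP => -[eS /eqP e0].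
  by rewrite e0 (negPf S0) in eS.
by rewrite -mulr_suml wsum_inner_part natr_sum.
Qed.

Lemma sum_card_fibres (e : {set V}) : (\sum_i #|e :&: fibre i|%SET = #|e|)%N.
Proof.
rewrite -sum1_card (partition_big L predT) //=; apply: eq_bigr => i _.
by rewrite -sum1_card; apply: eq_bigl => v; rewrite !inE.
Qed.

Lemma inner_part_le (e : {set V}) : e != finset.set0 -> inner_part e <= #|e|%:R.
Proof.
move=> e0; rewrite -sum_card_fibres natr_sum; apply: ler_sum => i _.
rewrite ler_nat; case: (boolP (e \subset _)) => // /finset.setIidPl ->.
by rewrite card_gt0.
Qed.

Lemma inner_part_ge0 (e : {set V}) : 0 <= inner_part e.
Proof. by apply: sumr_ge0. Qed.

Lemma sum_sqr_card_fibres (e : {set V}) :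
  \sum_i (#|e :&: fibre i|%SET%:R ^+ 2 : R) <= #|e|%:R ^+ 2.
Proof.
rewrite [leRHS]expr2 -{1}(sum_card_fibres e) natr_sum mulr_suml.
apply: ler_sum => i _; rewrite expr2 ler_wpM2l // ler_nat.
by apply: subset_leq_card; exact: finset.subsetIl.
Qed.

End Fibres.

(** * Subgraphs of the Johnson graph induced on intervals of sets *)

Section JohnsonCounts.
Variables n r s : nat.
Hypothesis sr : (s < r)%N.
Notation V := (johnson_vertex n r).
Implicit Types (u v : V) (B C X : {set 'I_n}).

Definition ones v : {set 'I_n} := [set i | val v i]%SET.

Lemma card_ones v : #|ones v| = r.
Proof.
rewrite -(eqP (valP v)) -sum1_card big_mkcond /=; apply: eq_bigr => i _.
by rewrite inE; case: (val v i).
Qed.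

Lemma innerE u v : inner u v = #|ones u :&: ones v|%SET.
Proof.
rewrite /inner -sum1_card [RHS]big_mkcond /=; apply: eq_bigr => i _.
by rewrite !inE; case: (val u i); case: (val v i).
Qed.

Lemma ones_inj : injective ones.
Proof.
move=> u v /setP e; apply: val_inj; apply/ffunP => i.
by have := e i; rewrite !inE.
Qed.

Lemma card_vertices (Q : pred {set 'I_n}) :
  #|[set v : V | Q (ones v)]%SET| = #|[set B : {set 'I_n} | (#|B| == r) && Q B]%SET|.
Proof.
rewrite -(card_imset _ ones_inj); apply: eq_card => B; rewrite inE.
apply/imsetP/andP.
- by case=> v; rewrite inE => Qv ->; rewrite card_ones eqxx.
- case=> /eqP cB QB.
  have h : (\sum_(i < n) [ffun i => i \in B] i)%N == r.
    rewrite -cB -sum1_card [X in _ == X]big_mkcond /=; apply/eqP.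
    by apply: eq_bigr => i _; rewrite ffunE; case: (i \in B).
  have e : B = ones (exist _ [ffun i => i \in B] h).
    by apply/setP => i; rewrite inE /= ffunE.
  by exists (exist _ [ffun i => i \in B] h) => //; rewrite inE -e.
Qed.

Definition jadj u v := inner u v == s.

Lemma jadj_sym : symmetric jadj.
Proof. by move=> u v; rewrite /jadj !innerE finset.setIC. Qed.

Lemma jadj_irr : irreflexive jadj.
Proof. by move=> v; rewrite /jadj innerE finset.setIid card_ones gtn_eqF. Qed.

Lemma johnsonE : johnson n r s = adj_edges jadj.
Proof.
apply/setP => e; rewrite !inE; apply: eq_existsb => u; apply: eq_existsb => v.
by case: eqP => // -> ; rewrite jadj_irr.
Qed.

(** All parts of the partition have this form: [C] is a singleton [[set i]] and [X] the coordinates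
    after [i], or [C] is empty and [X] consists of the last coordinates. *)
Definition between C X : {set V} :=
  [set v | (C \subset ones v) && (ones v \subset C :|: X)]%SET.

Lemma card_between C X : [disjoint C & X] -> (#|C| <= r)%N ->
  #|between C X| = 'C(#|X|, r - #|C|)%N.
Proof.
move=> dCX Cr; rewrite (card_vertices (fun B => (C \subset B) && (B \subset C :|: X)%SET)).
have := @card_draws_between _ C X finset.set0 (r - #|C|)%N 0%N dCX.
rewrite cards0 bin0 muln1 => <-; rewrite 1?disjoint_sym ?disjoint_set0 //.
apply: eq_card => B; rewrite !inE finset.setU0 finset.setI0 cards0 eqxx andbT.
rewrite [LHS]andbC -!andbA; case: (boolP (C \subset B)) => // CB.
case: (boolP (B \subset _)) => // BCX /=.
have -> : #|B| = (#|C| + #|B :&: X|%SET)%N.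
  rewrite -cardsUI (_ : _ :|: _ = B)%SET; last first.
    apply/setP => i; rewrite !inE; have := fintype.subsetP CB i.
    have := fintype.subsetP BCX i; rewrite !inE.
    by case: (i \in C); case: (i \in X); case: (i \in B) => //= h1 h2;
      (by have := h1 isT) || (by have := h2 isT).
  by rewrite finset.setICA (finset.disjoint_setI0 dCX) finset.setI0 cards0 addn0.
by rewrite -[r in LHS](subnKC Cr) eqn_add2l.
Qed.

(** A neighbour of [v] consists of [C], of [s - #|C|] further elements of [v], and of [r - s]
    elements of [X] outside [v]. The count does not depend on [v], so the induced subgraph is
    regular. *)
Lemma card_between_neighbours C X v : [disjoint C & X] -> (#|C| <= s)%N ->
  v \in between C X ->
  #|[set u in between C X | jadj u v]%SET| =
    ('C(r - #|C|, s - #|C|) * 'C(#|X| - (r - #|C|), r - s))%N.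
Proof.
move=> dCX Cs; rewrite inE => /andP[CW WCX].
transitivity #|[set B : {set 'I_n} | (#|B| == r) && [&& C \subset B, B \subset C :|: X
    & #|B :&: ones v| == s]]%SET|.
  rewrite -(card_vertices (fun B => [&& C \subset B, B \subset C :|: X
    & #|B :&: ones v| == s]%SET)); apply: eq_card => u.
  by rewrite !inE /jadj innerE andbA.
move: (ones v) (card_ones v) CW WCX => W cW CW WCX.
have dCY : [disjoint C & W :\: C]%SET.
  by rewrite -finset.setI_eq0; apply/eqP/setP => i; rewrite !inE; case: (i \in C).
have dCZ : [disjoint C & X :\: W]%SET by apply: disjointWr dCX; exact: finset.subsetDl.
have dYZ : [disjoint W :\: C & X :\: W]%SET.
  rewrite -finset.setI_eq0; apply/eqP/setP => i; rewrite !inE.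
  by case: (i \in W); rewrite ?andbF.
have cY : #|W :\: C|%SET = (r - #|C|)%N.
  by rewrite finset.cardsD (finset.setIidPr CW) cW.
have cXW : #|X :&: W|%SET = (r - #|C|)%N.
  rewrite -cY; apply: eq_card => i; rewrite !inE; have := fintype.subsetP WCX i.
  have := @disjointFr _ _ _ i dCX; rewrite !inE.
  by case: (i \in C); case: (i \in X); case: (i \in W) => //= h1 h2;
    (by have := h1 isT) || (by have := h2 isT).
have cZ : #|X :\: W|%SET = (#|X| - (r - #|C|))%N by rewrite finset.cardsD cXW.
have := @card_draws_between _ C _ _ (s - #|C|)%N (r - s)%N dCY dCZ dYZ.
rewrite cY cZ => <-.
apply: eq_card => B; rewrite !inE.
have -> : (C :|: W :\: C :|: X :\: W = C :|: X)%SET.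
  apply/setP => i; rewrite !inE; have := fintype.subsetP WCX i.
  have := fintype.subsetP CW i; rewrite !inE.
  by case: (i \in C); case: (i \in X); case: (i \in W) => //= h1 h2;
    (by have := h1 isT) || (by have := h2 isT).
rewrite [LHS]andbC -!andbA; case: (boolP (C \subset B)) => // CB.
case: (boolP (B \subset _)) => // BCX /=.
have -> : #|B| = (#|B :&: W|%SET + #|B :&: (X :\: W)|%SET)%N.
  rewrite -[LHS](cardsID W); congr (_ + _)%N; apply: eq_card => i; rewrite !inE.
  have := fintype.subsetP CW i.
  have := fintype.subsetP BCX i; rewrite !inE.
  by case: (i \in C); case: (i \in X); case: (i \in W); case: (i \in B) => //= h1 h2;
    (by have := h1 isT) || (by have := h2 isT).
have -> : #|B :&: W|%SET = (#|C| + #|B :&: (W :\: C)|%SET)%N.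
  rewrite -[LHS](cardsID C); congr (_ + _)%N; apply: eq_card => i; rewrite !inE.
    have := fintype.subsetP CW i; have := fintype.subsetP CB i.
    by case: (i \in C); case: (i \in W); case: (i \in B) => //= h1 h2;
      (by have := h1 isT) || (by have := h2 isT).
  by rewrite andbC -!andbA [X in _ && X]andbC.
move: Cs sr; move: #|C| #|B :&: (W :\: C)|%SET #|B :&: (X :\: W)|%SET => c y z Cs sr_.
by apply/andP/andP => -[/eqP h1 /eqP h2]; split; apply/eqP; lia.
Qed.

End JohnsonCounts.

(** Both sides count the pairs of disjoint subsets of sizes [a] and [b] in a set of size [x]. *)
Lemma bin_trinomial x a b : ('C(x, a) * 'C(x - a, b) = 'C(x, a + b) * 'C(a + b, a))%N.
Proof.
have [abx|xab] := leqP (a + b) x; last first.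
  rewrite (bin_small xab) mul0n; have [xa|ax] := ltnP x a.
    by rewrite bin_small.
  by rewrite (@bin_small (x - a)) ?muln0 //; lia.
have ax : (a <= x)%N by lia.
have bxa : (b <= x - a)%N by lia.
have e1 := bin_fact ax; have e2 := bin_fact bxa.
have e3 := bin_fact abx; have e4 := bin_fact (leq_addr b a).
rewrite addKn in e4; rewrite subnDA in e3.
have g : (0 < a`! * (b`! * (x - a - b)`!))%N by rewrite !muln_gt0 !fact_gt0.
apply/eqP; rewrite -(eqn_pmul2r g); apply/eqP.
transitivity x`!; first by rewrite -e1 -e2; ring.
by rewrite -e3 -e4; ring.
Qed.

(** Sorts the subsets of size [a.+1] by their least element [i] if [i < h]; the last term counts
    those avoiding the first [h] elements. *)
Lemma hockey_stick n h a : (h <= n)%N ->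
  (\sum_(i < h) 'C(n - i.+1, a) + 'C(n - h, a.+1) = 'C(n, a.+1))%N.
Proof.
elim: h => [|h IH] hn; first by rewrite big_ord0 subn0.
rewrite big_ord_recr /= -[RHS]IH ?(ltnW hn) // -addnA; congr (_ + _)%N.
by rewrite -(subnSK hn) binS addnC.
Qed.

Section JohnsonDegree.
Variables n r s : nat.
Hypothesis sr : (s < r)%N.
Notation V := (johnson_vertex n r).
Notation k := (r + (r - s))%N.
Notation between := (@between n r).
Implicit Types (u v : V).
Notation E := (johnson n r s).
Notation D := ('C(r, s) * 'C(n - r, r - s))%N.

(** The right-hand side counts ordered adjacent pairs: choose the union, of size [k], then the first
    set inside it, then the intersection, always outside [C]. Starting with the union puts the
    dependence on [#|X|] into one binomial coefficient. *)
Lemma two_edges_within (C X : {set 'I_n}) : [disjoint C & X] -> (#|C| <= s)%N ->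
  (2 * #|edges_within E (between C X)| =
   'C(#|X|, k - #|C|) * ('C(k - #|C|, r - #|C|) * 'C(r - #|C|, s - #|C|)))%N.
Proof.
move=> dCX Cs; have Cr : (#|C| <= r)%N by lia.
rewrite (johnsonE n sr) -(sum_card_neighbours (@jadj_sym n r s) (jadj_irr sr)).
rewrite (eq_bigr _ (fun v vA => card_between_neighbours sr dCX Cs vA)).
rewrite sum_nat_const card_between // [in RHS]mulnA.
have -> : (k - #|C| = (r - #|C|) + (r - s))%N by lia.
by rewrite -bin_trinomial mulnA -!mulnA; congr (_ * _)%N; rewrite mulnC.
Qed.

Lemma degree_johnson v : degree E v = D.
Proof.
have d0 : [disjoint finset.set0 & [set: 'I_n]%SET] by rewrite disjoint_set0.
rewrite (johnsonE n sr) -(edges_withinT (adj_edges _)).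
rewrite (degree_edges_within (@jadj_sym n r s) (jadj_irr sr)); last by rewrite inE.
have vb : v \in between finset.set0 [set: 'I_n]%SET.
  by rewrite inE finset.sub0set finset.set0U finset.subsetT.
have := card_between_neighbours sr d0 _ vb.
rewrite cards0 !subn0 cardsT card_ord => <- //.
by apply: eq_card => u; rewrite !inE finset.sub0set finset.set0U finset.subsetT.
Qed.

Lemma sum_card_edges_cap (A : {set V}) : (\sum_(e in E) #|e :&: A|%SET = #|A| * D)%N.
Proof.
by rewrite -sum_degree (eq_bigr _ (fun v _ => degree_johnson v)) sum_nat_const.
Qed.

Lemma betweenT : between finset.set0 [set: 'I_n]%SET = [set: V]%SET.
Proof. by apply/setP => v; rewrite !inE finset.sub0set finset.set0U finset.subsetT. Qed.

Lemma card_johnson : (2 * #|E| = 'C(n, k) * ('C(k, r) * 'C(r, s)))%N.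
Proof.
have d0 : [disjoint finset.set0 & [set: 'I_n]%SET] by rewrite disjoint_set0.
have := two_edges_within d0; rewrite betweenT edges_withinT cards0 !subn0 => -> //.
by rewrite cardsT card_ord.
Qed.

(** The same number as vertices times degree, the form in which proportions of degrees become ratios
    of numbers of [r]-sets. *)
Lemma card_johnson_degree : (2 * #|E| = 'C(n, r) * D)%N.
Proof. by rewrite card_johnson mulnA -bin_trinomial -mulnA; congr (_ * _)%N; rewrite mulnC. Qed.

End JohnsonDegree.

(** * The partition of the r-sets by least element *)

Section JohnsonPartition.
Variables n r s h : nat.
Hypotheses (s0 : (0 < s)%N) (sr : (s < r)%N) (hn : (h <= n)%N).
Notation V := (johnson_vertex n r).
Notation k := (r + (r - s))%N.
Notation between := (@between n r).
Implicit Types (u v : V).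

Definition tail t : {set 'I_n} := [set j : 'I_n | (t <= j)%N]%SET.

Lemma card_tail t : #|tail t| = (n - t)%N.
Proof.
have [tn|nt] := leqP t n; last first.
  rewrite (_ : tail t = finset.set0) ?cards0; first by lia.
  by apply/setP => j; rewrite !inE; have := ltn_ord j; lia.
rewrite -[X in (X - t)%N](card_ord n) -(cardC (mem (tail t))) -[LHS](addnK t).
congr (_ + _ - _)%N; apply/esym.
have inj : injective (widen_ord tn) by move=> i j /(congr1 val) /= /val_inj.
rewrite -[RHS](card_ord t) -(card_imset predT inj).
apply: eq_card => j; rewrite !inE -ltnNge; apply/idP/imsetP.
  by move=> jt; exists (Ordinal jt) => //; apply: val_inj.
by case=> i _ ->; exact: (ltn_ord i).
Qed.

(* The value [None] stands for the part of the r-sets avoiding {0, ..., h - 1};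
   otherwise the label is the least element. *)
Definition label v : option 'I_n :=
  [pick i : 'I_n | (i < h)%N && (v \in between [set i]%SET (tail i.+1))].

Lemma disjoint_tail (i : 'I_n) : [disjoint [set i]%SET & tail i.+1].
Proof. by rewrite disjoints1 !inE ltnn. Qed.

Lemma between_first (i j : 'I_n) v :
  v \in between [set i]%SET (tail i.+1) -> j \in ones v -> (i <= j)%N.
Proof.
rewrite inE => /andP[_ /fintype.subsetP/(_ j) S] /S.
by rewrite !inE => /orP[/eqP ->//|/ltnW].
Qed.

(** Two candidates for the label of [v] both belong to [v] and bound it from below, hence
    coincide. *)
Lemma fibre_some (i : 'I_n) : (i < h)%N ->
  fibre label (Some i) = between [set i]%SET (tail i.+1).
Proof.
move=> ih; apply/setP => v; rewrite inE /label.
case: pickP => [j /andP[jh vj]|/(_ i)]; last by rewrite ih /= => ->.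
apply/eqP/idP => [[<-]//|vi]; congr Some; apply: val_inj; apply/eqP.
have si w : v \in between [set w]%SET (tail w.+1) -> w \in ones v.
  by rewrite inE finset.sub1set => /andP[].
by rewrite eqn_leq (between_first vj (si _ vi)) (between_first vi (si _ vj)).
Qed.

Lemma fibre_some_ge (i : 'I_n) : (h <= i)%N -> fibre label (Some i) = finset.set0.
Proof.
move=> hi; apply/setP => v; rewrite !inE /label.
case: pickP => // j /andP[jh _]; apply/eqP => -[ji].
by rewrite ji ltnNge hi in jh.
Qed.

Lemma fibre_none : fibre label None = between finset.set0 (tail h).
Proof.
apply/setP => v; rewrite !inE finset.sub0set finset.set0U /= /label.
case: pickP => [i /andP[ih]|nov] /=.
  rewrite inE finset.sub1set => /andP[iv _].
  by apply/esym/negP => /fintype.subsetP/(_ i iv); rewrite inE leqNgt ih.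
apply/esym/fintype.subsetP => i iv; rewrite inE leqNgt; apply/negP => ih.
(* If [v] meets the first [h] coordinates, its least element is a valid label, contrary to [nov]. *)
case: (@arg_minnP _ i (mem (ones v)) (fun j => j : nat) iv) => j jv jmin.
have := nov j; rewrite (leq_ltn_trans (jmin i iv) ih) /= => /negP; apply.
rewrite inE finset.sub1set; apply/andP; split => //.
by apply/fintype.subsetP => l lv; rewrite !inE -val_eqE /= eq_sym -leq_eqVlt; exact: jmin.
Qed.

Notation E := (johnson n r s).
Notation D := ('C(r, s) * 'C(n - r, r - s))%N.

Lemma sum_edges_none :
  (\sum_(e in E) #|e :&: fibre label None|%SET = 'C(n - h, r) * D)%N.
Proof.
rewrite (sum_card_edges_cap sr) fibre_none card_between ?cards0 ?subn0 ?card_tail //.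
by rewrite disjoint_set0.
Qed.

(** There are ['C(n - i.+1, r.-1)] sets with least element [i], most for [i = 0]. The bound is
    uniform in [i], as needed to make the squared degrees of these parts negligible. *)
Lemma sum_edges_some (i : 'I_n) :
  (\sum_(e in E) #|e :&: fibre label (Some i)|%SET <= 'C(n.-1, r.-1) * D)%N.
Proof.
rewrite (sum_card_edges_cap sr) leq_mul2r; apply/orP; right.
have [ih|hi] := ltnP i h; last by rewrite fibre_some_ge // cards0.
rewrite fibre_some // card_between ?cards1 ?card_tail; last 2 first.
- exact: disjoint_tail.
- by lia.
by rewrite subn1 leq_bin2l //; lia.
Qed.

(** With [N] edges in all and [M] inside parts, this is [M / N = s / k + (1 - s / k) * 'C(n - h, k)
    / 'C(n, k)] without denominators; the negative term stands on the left to avoid truncated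
    subtraction. *)
Lemma sum_edges_within_fibres :
  (k * (2 * \sum_i #|edges_within E (fibre label i)|)
     + s * ('C(n - h, k) * ('C(k, r) * 'C(r, s)))
   = k * ('C(n - h, k) * ('C(k, r) * 'C(r, s)))
     + s * ('C(n, k) * ('C(k, r) * 'C(r, s))))%N.
Proof.
have -> : (\sum_i #|edges_within E (fibre label i)| =
    #|edges_within E (fibre label None)| + \sum_i #|edges_within E (fibre label (Some i))|)%N.
  exact: big_option.
rewrite fibre_none /= mulnDr (two_edges_within sr) ?cards0 ?disjoint_set0 //.
rewrite !subn0 card_tail.
have -> : (2 * \sum_i #|edges_within E (fibre label (Some i))| =
    \sum_(i < h) 'C(n - i.+1, k.-1) * ('C(k.-1, r.-1) * 'C(r.-1, s.-1)))%N.
  rewrite big_distrr /= (big_ord_widen _ (fun i =>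
    'C(n - i.+1, k.-1) * ('C(k.-1, r.-1) * 'C(r.-1, s.-1)))%N hn).
  rewrite [RHS]big_mkcond /=; apply: eq_bigr => i _; case: ltnP => [ih|hi].
    rewrite fibre_some // (two_edges_within sr) ?cards1 ?card_tail ?subn1 //.
    exact: disjoint_tail.
  (* For [h <= i] the fibre is empty and contains no edge, since edges have endpoints. *)
  rewrite fibre_some_ge //; apply/eqP; rewrite muln_eq0 /= cards_eq0.
  apply/eqP/setP => e; rewrite !inE finset.subset0; apply/andP => -[/existsP[u /existsP[v]]].
  by case/and3P => _ _ /eqP -> /eqP/setP/(_ u); rewrite !inE eqxx.
rewrite -big_distrl /=.
(* The two absorption identities together produce the proportion [s / k]. *)
have e1 : (k * 'C(k.-1, r.-1) = r * 'C(k, r))%N.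
  by rewrite mul_bin_diag prednK //; lia.
have e2 : (r * 'C(r.-1, s.-1) = s * 'C(r, s))%N.
  by rewrite mul_bin_diag prednK //; lia.
have := @hockey_stick n h k.-1 hn; rewrite prednK; last by lia.
move: (\sum_(i < h) _)%N => S <-.
have e3 : (k * (S * ('C(k.-1, r.-1) * 'C(r.-1, s.-1))) = s * (S * ('C(k, r) * 'C(r, s))))%N.
  have -> : (k * (S * ('C(k.-1, r.-1) * 'C(r.-1, s.-1)))
    = S * (k * 'C(k.-1, r.-1)) * 'C(r.-1, s.-1))%N by ring.
  rewrite e1; have -> : (S * (r * 'C(k, r)) * 'C(r.-1, s.-1)
    = S * 'C(k, r) * (r * 'C(r.-1, s.-1)))%N by ring.
  by rewrite e2; ring.
by rewrite mulnDr e3; ring.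
Qed.

End JohnsonPartition.

(** * Second moments and almost sure convergence *)

Section Mean.
Context {d : measure_display} {T : measurableType d} {R : realType}.
Variable P : probability T R.

(** Integrability is bundled with the value of the mean, so that linearity applies without side
    conditions. *)
Definition has_mean (X : T -> R) (m : R) : Prop :=
  P.-integrable [set: T] (EFin \o X) /\ (\int[P]_w (X w)%:E = m%:E)%E.

Lemma has_mean_ext X Y m : (forall w, X w = Y w) -> has_mean X m -> has_mean Y m.
Proof. by move=> /funext ->. Qed.

Lemma has_mean_cst c : has_mean (fun=> c) c.
Proof.
split; first exact: (finite_measure_integrable_cst _ c measurableT).
by rewrite (integral_cst _ measurableT c%:E) /= probability_setT mule1.
Qed.

Lemma has_mean_indic A : measurable A -> has_mean \1_A (fine (P A)).
Proof.
move=> mA; split; first exact: integrable_indic.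
by rewrite integral_indic // setIT fineK // fin_num_measure.
Qed.

Lemma has_meanD X Y m m' :
  has_mean X m -> has_mean Y m' -> has_mean (fun w => X w + Y w) (m + m').
Proof.
move=> [iX eX] [iY eY]; split; first exact: (integrableD measurableT iX iY).
by rewrite integralD_EFin // eX eY.
Qed.

Lemma has_meanZ c X m : has_mean X m -> has_mean (fun w => c * X w) (c * m).
Proof.
move=> [iX eX]; split; first exact: (integrableZl measurableT c iX).
under eq_integral do rewrite EFinM.
by rewrite integralZl // eX.
Qed.

Lemma has_mean_sum (I : Type) (s : seq I) (Q : pred I) (X : I -> T -> R) (m : I -> R) :
  (forall i, Q i -> has_mean (X i) (m i)) ->
  has_mean (fun w => \sum_(i <- s | Q i) X i w) (\sum_(i <- s | Q i) m i).
Proof.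
move=> XQ; elim: s => [|i s IH].
  rewrite big_nil; apply: has_mean_ext (has_mean_cst 0) => w.
  by rewrite big_nil.
rewrite big_cons; case: (boolP (Q i)) => Qi.
  apply: has_mean_ext (has_meanD (XQ _ Qi) IH) => w.
  by rewrite big_cons Qi.
apply: has_mean_ext IH => w.
by rewrite big_cons (negbTE Qi).
Qed.

End Mean.

(** * Variance of weighted edge sums in the random subgraph *)

Section RandomSubgraphVariance.
Context {d : measure_display} {T : measurableType d} {R : realType}.
Variable P : probability T R.
Variables (V : finType) (E : {set {set V}}) (p : R) (H : T -> {set {set V}}).
Hypothesis rsH : random_subgraph P E p H.

Let removed e : set T := [set w | e \notin H w]%classic.
Let Z e (w : T) : R := \1_(removed e) w - (1 - p).

(** Expresses the deviation by the centred removal indicators: [Z] is [p - 1] at an edge that is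
    kept and [p] at a removed one. *)
Lemma wsum_random_subgraph (f : {set V} -> R) w :
  wsum f (H w) - p * wsum f E = - \sum_(e in E) f e * Z e w.
Proof.
have [sub _ _] := rsH.
rewrite /wsum mulr_sumr [X in _ - X](big_setID (H w)) /= (finset.setIidPr (sub w)).
rewrite [X in _ = - X](big_setID (H w)) /= (finset.setIidPr (sub w)).
rewrite opprD addrA -sumrB [RHS]opprD -!sumrN; congr (_ + _); apply: eq_bigr => e.
  move=> eH; rewrite /Z indicE memNset /=; last by rewrite /removed /= eH.
  by ring.
rewrite !inE => /andP[eH _]; rewrite /Z indicE mem_set //=.
by ring.
Qed.

(** The product expands into the indicator of the joint removal, two single indicators and a
    constant. Joint removal has probability [1 - p] if [e = e'], and [(1 - p) ^+ 2] otherwise by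
    independence. *)
Lemma has_mean_cross e e' : e \in E -> e' \in E ->
  has_mean P (fun w => Z e w * Z e' w) (if e == e' then p * (1 - p) else 0).
Proof.
move=> eE e'E; have [_ Pr [mr ind]] := rsH.
have me := mr _ eE; have me' := mr _ e'E.
have mee' := measurableI _ _ me me'.
have H1 := has_mean_indic P mee'.
have H2 := has_meanZ (- (1 - p)) (has_mean_indic P me).
have H3 := has_meanZ (- (1 - p)) (has_mean_indic P me').
have H4 := has_mean_cst P ((1 - p) ^+ 2).
have := has_meanD (has_meanD (has_meanD H1 H2) H3) H4.
rewrite (Pr _ eE) (Pr _ e'E) /=.
have -> : fine (P (removed e `&` removed e')%classic) =
    if e == e' then 1 - p else (1 - p) ^+ 2.
  case: eqP => [<-|/eqP ne]; first by rewrite setIid (Pr _ eE).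
  have := ind [set e; e']%SET.
  have -> : (\bigcap_(i in [set` [set e; e']%SET]) removed i =
             removed e `&` removed e')%classic.
    apply/seteqP; split => w /=.
      by move=> h; split; apply: h; rewrite /= !inE eqxx ?orbT.
    by move=> [h h'] i /=; rewrite !inE => /orP[] /eqP ->.
  rewrite big_setU1 ?inE //= big_set1 => ->.
    by rewrite (Pr _ eE) (Pr _ e'E) -EFinM.
  by apply/fintype.subsetP => i; rewrite !inE => /orP[] /eqP ->.
move=> h; rewrite [X in has_mean _ _ X](_ : _ =
    (if e == e' then 1 - p else (1 - p) ^+ 2) + - (1 - p) * (1 - p)
    + - (1 - p) * (1 - p) + (1 - p) ^+ 2); last by case: ifP => _; ring.
apply: has_mean_ext h => w; rewrite /Z indicI /=.
by ring.
Qed.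

(** In the expanded square only the diagonal terms have nonzero mean. *)
Lemma has_mean_sqr_deviation (f : {set V} -> R) :
  has_mean P (fun w => (wsum f (H w) - p * wsum f E) ^+ 2)
    (p * (1 - p) * \sum_(e in E) f e ^+ 2).
Proof.
have h := has_mean_sum (index_enum _) (fun e (eE : e \in E) =>
  has_mean_sum (index_enum _) (fun e' (e'E : e' \in E) =>
    has_meanZ (f e * f e') (has_mean_cross eE e'E))).
rewrite [X in has_mean _ _ X](_ : _ = \sum_(e in E) \sum_(e' in E)
    f e * f e' * (if e == e' then p * (1 - p) else 0)); last first.
  rewrite mulr_sumr; apply: eq_bigr => e eE; rewrite (bigD1 e) //= eqxx big1.
    by rewrite addr0; ring.
  by move=> e' /andP[_ /negPf]; rewrite eq_sym => ->; rewrite mulr0.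
apply: has_mean_ext h => w; rewrite wsum_random_subgraph sqrrN expr2 mulr_suml.
apply: eq_bigr => e _; rewrite mulr_sumr; apply: eq_bigr => e' _.
by ring.
Qed.

End RandomSubgraphVariance.

(** * Almost sure convergence from summable means *)

Section AlmostSure.
Context {d : measure_display} {T : measurableType d} {R : realType}.
Variable P : probability T R.

Lemma sum_inv_consecutive N : \sum_(0 <= n < N) (n.+1%:R * n.+2%:R)^-1 = 1 - N.+1%:R^-1 :> R.
Proof.
elim: N => [|N IH]; first by rewrite big_nil invr1 subrr.
rewrite big_nat_recr //= IH.
have n1 : (N.+1%:R : R) != 0 by rewrite pnatr_eq0.
have n2 : (N.+2%:R : R) != 0 by rewrite pnatr_eq0.
have e : N.+2%:R = N.+1%:R + 1 :> R by rewrite natr1.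
rewrite e in n2 *; move: (N.+1%:R : R) n1 n2 => x n1 n2; field.
by rewrite n1 n2.
Qed.

(** By monotone convergence the sum of the series has mean at most [C], because the majorant
    telescopes. Hence the series converges almost surely, and its terms tend to 0. *)
Lemma summable_means_cvg0 (D : nat -> T -> R) (m : nat -> R) (C : R) :
  (forall n w, 0 <= D n w) -> (forall n, has_mean P (D n) (m n)) ->
  (forall n, m n <= C * (n.+1%:R * n.+2%:R)^-1) ->
  {ae P, forall w, (D n w @[n --> \oo] --> (0 : R))%classic}.
Proof.
move=> D0 Dm mC.
have mD n : measurable_fun [set: T] (EFin \o D n).
  by have [/integrableP[]] := Dm n.
pose S w := (\sum_(n <oo) (D n w)%:E)%E.
have S0 w : (0 <= S w)%E by apply: nneseries_ge0 => n _ _; rewrite lee_fin.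
have mS : measurable_fun [set: T] S.
  by apply: (ge0_emeasurable_sum (h := fun n => EFin \o D n)) => // n w _ _; rewrite lee_fin.
have C0 : 0 <= C.
  have : 0 <= m 0%N.
    by rewrite -lee_fin -(Dm 0%N).2 integral_ge0 // => w _; rewrite lee_fin.
  by move/le_trans/(_ (mC 0%N)); rewrite pmulr_lge0 // invr_gt0 mulr_gt0.
have iS : P.-integrable [set: T] S.
  apply/integrableP; split => //.
  under eq_integral do rewrite gee0_abs //.
  rewrite integral_nneseries //; last by move=> n w _; rewrite lee_fin.
  apply: (@le_lt_trans _ _ C%:E); last exact: ltry.
  apply: lime_le.
    by apply: is_cvg_nneseries => n _ _; apply: integral_ge0 => w _; rewrite lee_fin.
  apply: nearW => N.
  rewrite (eq_bigr (fun n => (m n)%:E)); last by move=> n _; exact: (Dm n).2.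
  rewrite sumEFin lee_fin.
  apply: (@le_trans _ _ (\sum_(0 <= n < N) C * (n.+1%:R * n.+2%:R)^-1)).
    by apply: ler_sum => n _; exact: mC.
  rewrite -mulr_sumr sum_inv_consecutive -[leRHS]mulr1; apply: ler_wpM2l => //.
apply: filterS (integrable_ae measurableT iS) => w /(_ I) fS.
have D0' : (forall n, true -> (0 <= (D n w)%:E)%E) by move=> n _; rewrite lee_fin.
apply: (@cvg_series_cvg_0 _ _ (D ^~ w)); apply: nondecreasing_is_cvgn.
  by apply: nondecreasing_series => n _ _; exact: D0.
exists (fine (S w)) => _ [N _ <-]; rewrite -lee_fin fineK // /series /= -sumEFin.
by apply: nneseries_lim_ge => n _; exact: D0'.
Qed.

End AlmostSure.

(** Here [a] is the proportion of edges inside parts and [b] the sum of the squared proportions of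
    degrees in the full graph, [t] bounds the relative deviations, and [u] is the number of kept
    edges divided by its mean. *)
Definition modularity_bound (R : realType) (a b t u : R) : R :=
  (a - t) / u - (b + t + t ^+ 2) / u ^+ 2.

(** * Modularity of a subgraph in terms of relative deviations *)

Section FibreDegree.
Variables (R : realType) (V I : finType) (L : V -> I) (E : {set {set V}}).
Hypotheses (card2 : forall e, e \in E -> #|e| = 2) (E_gt0 : 0 < #|E|%:R :> R).

Definition fibre_degree i (e : {set V}) : R := #|e :&: fibre L i|%SET%:R.

Lemma sum_fibre_degree : \sum_i (wsum (fibre_degree i) E / (2 * #|E|%:R)) = 1.
Proof.
rewrite -mulr_suml exchange_big /= (eq_bigr (fun=> 2)); last first.
  by move=> e eE; rewrite -natr_sum sum_card_fibres card2.
rewrite sumr_const -[2 *+ _]mulr_natr divff //.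
by rewrite mulf_neq0 ?gt_eqF.
Qed.

Lemma fibre_degree_ge0 i S : 0 <= wsum (fibre_degree i) S.
Proof. by apply: sumr_ge0. Qed.

End FibreDegree.

Section Deviation.
Variables (R : realType) (V I : finType) (L : V -> I).
Variables (E S : {set {set V}}) (p : R).
Hypotheses (SE : S \subset E) (card2 : forall e, e \in E -> #|e| = 2).
Hypothesis pE : 0 < p * #|E|%:R.

Definition deviation (f : {set V} -> R) : R :=
  (wsum f S - p * wsum f E) / (p * #|E|%:R).

Notation fibre_degree := (fibre_degree R L).

(** Summing over the labels controls all parts at once, although their number grows with [n] in the
    application. *)
Definition sqr_deviation : R :=
  deviation (fun=> 1) ^+ 2 + deviation (inner_part R L) ^+ 2
  + \sum_i deviation (fibre_degree i) ^+ 2.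

Let E_gt0 : 0 < #|E|%:R :> R.
Proof.
by rewrite lt_neqAle ler0n andbT; apply: contraTneq pE => <-; rewrite mulr0 ltxx.
Qed.

Let p_gt0 : 0 < p. Proof. by move: pE; rewrite pmulr_lgt0. Qed.

Lemma wsum_deviation f : wsum f S = p * #|E|%:R * (wsum f E / #|E|%:R + deviation f).
Proof.
rewrite /deviation; move: (wsum f S) (wsum f E) => x z.
by field; rewrite !gt_eqF.
Qed.

(** The square root [t] dominates each single deviation. With [bi] the proportions of degrees, of
    sum 1, and [di] their deviations, the sum of [(bi + di / 2) ^+ 2] is at most
    [b + t + t ^+ 2]. *)
Lemma modularity_ge_deviation :
  modularity_bound (wsum (inner_part R L) E / #|E|%:R)
    (\sum_i (wsum (fibre_degree i) E / (2 * #|E|%:R)) ^+ 2)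
    (Num.sqrt sqr_deviation) (1 + deviation (fun=> 1)) <= modularity R S.
Proof.
rewrite /modularity_bound; set a := _ / _; set b := \sum_i _.
set t := Num.sqrt _; set u := 1 + _.
have le_t x : x ^+ 2 <= sqr_deviation -> `|x| <= t.
  by move=> xD; rewrite -sqrtr_sqr ler_sqrt // (le_trans _ xD) // sqr_ge0.
have S0 : finset.set0 \notin S.
  by apply/negP => /(fintype.subsetP SE)/card2; rewrite cards0.
have D0 : 0 <= \sum_i deviation (fibre_degree i) ^+ 2.
  by apply: sumr_ge0 => i _; exact: sqr_ge0.
have t_inner : `|deviation (inner_part R L)| <= t.
  by apply: le_t; rewrite /sqr_deviation -addrA addrCA lerDl addr_ge0 // sqr_ge0.
have t_fibre i : `|deviation (fibre_degree i)| <= t.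
  apply: le_t; apply: le_trans (_ : \sum_i deviation (fibre_degree i) ^+ 2 <= _).
    by rewrite (bigD1 i) //= lerDl; apply: sumr_ge0 => j _; exact: sqr_ge0.
  by rewrite /sqr_deviation lerDr addr_ge0 // sqr_ge0.
have t2 : t ^+ 2 = sqr_deviation by rewrite sqr_sqrtr // !addr_ge0 ?sqr_ge0.
have t0 : 0 <= t by exact: sqrtr_ge0.
have wS1 : wsum (fun=> 1) S = p * #|E|%:R * u.
  by rewrite wsum_deviation wsum1 divff ?gt_eqF.
have u0 : 0 <= u.
  by rewrite -(pmulr_rge0 _ pE) -wS1 wsum1.
have [_ maxE] := modularityP R S.
apply: le_trans (maxE _ (preim_partitionP L _)).
rewrite modularity_of_fibres // wS1; apply: lerB.
  rewrite wsum_deviation -mulf_div divff ?gt_eqF // mul1r ler_wpM2r ?invr_ge0 //.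
  by rewrite -/a lerD2l lerNl; apply: le_trans (ler_norm _) _; rewrite normrN.
pose bi i := wsum (fibre_degree i) E / (2 * #|E|%:R).
pose di i := deviation (fibre_degree i).
(* The factor 1/2 arises because [bi] is relative to the sum of degrees and [di] to the number of
   edges. *)
rewrite (eq_bigr (fun i => (bi i + di i / 2) ^+ 2 / u ^+ 2)); last first.
  move=> i _; rewrite -/(fibre_degree i) wsum_deviation -/(di i).
  have -> : wsum (fibre_degree i) E / #|E|%:R = 2 * bi i.
    by rewrite /bi; field; rewrite gt_eqF.
  (* If no edge is kept, both sides are 0 by the convention [x / 0 = 0]. *)
  have [->|un0] := eqVneq u 0; first by rewrite !(mulr0, expr0n, invr0) /=.
  by field; rewrite un0 !gt_eqF.
rewrite -mulr_suml ler_wpM2r ?invr_ge0 ?exprn_ge0 //.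
have bi0 i : 0 <= bi i.
  by rewrite divr_ge0 ?mulr_ge0 // fibre_degree_ge0.
apply: (@le_trans _ _ (\sum_i (bi i ^+ 2 + bi i * t + di i ^+ 2))).
  apply: ler_sum => i _.
  have : bi i * di i <= bi i * t.
    by rewrite ler_wpM2l // (le_trans _ (t_fibre i)) // ler_norm.
  have := sqr_ge0 (di i); nra.
rewrite !big_split /= -mulr_suml sum_fibre_degree // mul1r lerD2l t2.
by rewrite lerDr addr_ge0 // sqr_ge0.
Qed.

End Deviation.

Section SqrDeviationMean.
Context {d : measure_display} {T : measurableType d} {R : realType}.
Variables (P : probability T R) (V I : finType) (L : V -> I).
Variables (E : {set {set V}}) (p : R) (H : T -> {set {set V}}).
Hypotheses (rsH : random_subgraph P E p H) (card2 : forall e, e \in E -> #|e| = 2).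
Hypotheses (p01 : 0 <= p <= 1).

Lemma has_mean_deviation f : has_mean P (fun w => deviation E (H w) p f ^+ 2)
  (p * (1 - p) * (\sum_(e in E) f e ^+ 2) / (p * #|E|%:R) ^+ 2).
Proof.
rewrite mulrC; apply: has_mean_ext (has_meanZ _ (has_mean_sqr_deviation rsH f)) => w /=.
by rewrite /deviation [in RHS]exprMn exprVn mulrC.
Qed.

(* Holds also when p * #|E| = 0, where both sides are 0 as x / 0 = 0. *)
Lemma has_mean_sqr_deviation_le :
  exists2 m, has_mean P (fun w => sqr_deviation L E (H w) p) m
    & m <= 9 / (p * #|E|%:R).
Proof.
have /andP[p0 p1] := p01.
pose M : R := p * #|E|%:R.
pose c := p * (1 - p) / M ^+ 2.
pose ms (f : {set V} -> R) : R := \sum_(e in E) f e ^+ 2.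
have cE f : p * (1 - p) * ms f / M ^+ 2 = c * ms f by rewrite /c mulrAC.
exists (c * (ms (fun=> 1) + ms (inner_part R L) + \sum_i ms (fibre_degree R L i))).
  rewrite !mulrDr; apply: has_meanD; first apply: has_meanD.
  - by rewrite -cE; exact: has_mean_deviation.
  - by rewrite -cE; exact: has_mean_deviation.
  - by rewrite mulr_sumr; apply: has_mean_sum => i _; rewrite -cE; exact: has_mean_deviation.
rewrite -/M.
have [M0|M0] := eqVneq M 0; first by rewrite /c M0 expr0n /= !invr0 !mulr0 mul0r.
have Mgt0 : 0 < M by rewrite lt_neqAle eq_sym M0 mulr_ge0.
have sum_le (f : {set V} -> R) (b : R) : (forall e, e \in E -> f e <= b) ->
    \sum_(e in E) f e <= b * #|E|%:R.
  by move=> h; rewrite mulr_natr -sumr_const; exact: ler_sum.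
(* The constant 9 is 1 + 4 + 4: an edge contributes 1 to the first sum and at most [#|e| ^ 2 = 4] to
   each of the other two. *)
have m1 : ms (fun=> 1) <= 1 * #|E|%:R by apply: sum_le => e _; rewrite expr1n.
have m2 : ms (inner_part R L) <= 4 * #|E|%:R.
  apply: sum_le => e eE; have -> : 4 = 2 ^+ 2 :> R by rewrite -natrX.
  have : inner_part R L e <= #|e|%:R by apply: inner_part_le; rewrite -card_gt0 card2.
  by rewrite card2 // => le2; rewrite ler_sqr ?nnegrE ?inner_part_ge0.
have m3 : \sum_i ms (fibre_degree R L i) <= 4 * #|E|%:R.
  rewrite exchange_big /=; apply: sum_le => e eE.
  by apply: le_trans (sum_sqr_card_fibres R L e) _; rewrite card2 // -natrX.
have c0 : 0 <= c by rewrite divr_ge0 ?exprn_ge0 ?mulr_ge0 ?subr_ge0 // ltW.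
apply: (@le_trans _ _ (c * (9 * #|E|%:R))).
  apply: ler_wpM2l => //; move: m1 m2 m3; lra.
have -> : c * (9 * #|E|%:R) = (1 - p) * (9 / M).
  by rewrite /c /M; field; move: M0; rewrite /M mulf_eq0 negb_or andbC.
by apply: ler_piMl; rewrite ?gerBl // divr_ge0 // ltW.
Qed.

End SqrDeviationMean.

(** * Limits *)

Section JohnsonSize.
Variables (R : realType) (n r s : nat).
Hypothesis sr : (s < r)%N.
Notation k := (r + (r - s))%N.
Notation E := (johnson n r s).

Lemma card_johnson_edge e : e \in E -> #|e| = 2.
Proof. by rewrite (johnsonE n sr); apply: card_adj_edge; exact: jadj_irr. Qed.

(** For [2 * k <= n] each of the [k] factors of the falling factorial of [n] is at least [n / 2]. *)
Lemma card_johnson_ge : (2 * k <= n)%N ->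
  (2 * (2 ^ k * k`!))%:R^-1 * n%:R ^+ k <= #|E|%:R :> R.
Proof.
move=> kn2; rewrite mulrC ler_pdivrMr; last first.
  by rewrite ltr0n !muln_gt0 expn_gt0 fact_gt0.
rewrite -natrX -natrM ler_nat mulnA [(_ * 2)%N]mulnC card_johnson //.
have G1 : (1 <= 'C(k, r) * 'C(r, s))%N.
  by rewrite muln_gt0 !bin_gt0 leq_addr (ltnW sr).
apply: (@leq_trans ('C(n, k) * (2 ^ k * k`!))); last first.
  by rewrite leq_mul2r; apply/orP; right; rewrite leq_pmulr.
rewrite mulnCA bin_ffact ffact_prod.
rewrite -[X in (n ^ X)%N](card_ord k) -[X in (2 ^ X)%N](card_ord k).
rewrite -!prod_nat_const -big_split /=.
by apply: leq_prod => i _; have := ltn_ord i; lia.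
Qed.

End JohnsonSize.

Section JohnsonRatios.
Variables (R : realType) (n r s h : nat).
Hypotheses (s0 : (0 < s)%N) (sr : (s < r)%N) (hn : (h <= n)%N).
Notation k := (r + (r - s))%N.
Notation E := (johnson n r s).
Hypothesis kn : (k <= n)%N.

Lemma card_johnson_gt0 : 0 < #|E|%:R :> R.
Proof.
rewrite ltr0n -(ltn_pmul2l (isT : 0 < 2)%N) muln0 card_johnson // !muln_gt0 !bin_gt0.
by rewrite kn leq_addr (ltnW sr).
Qed.

Lemma wsum_inner_part_johnson :
  wsum (inner_part R (@label n r h)) E / #|E|%:R =
  s%:R / k%:R + (1 - s%:R / k%:R) * ('C(n - h, k)%:R / 'C(n, k)%:R).
Proof.
rewrite wsum_inner_part.
have := sum_edges_within_fibres s0 sr hn; have := card_johnson n sr.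
have N0 := card_johnson_gt0.
have G0 : 0 < ('C(k, r) * 'C(r, s))%N%:R :> R.
  by rewrite ltr0n muln_gt0 !bin_gt0 leq_addr (ltnW sr).
have C0 : 0 < 'C(n, k)%:R :> R by rewrite ltr0n bin_gt0.
have k0 : 0 < k%:R :> R by rewrite ltr0n; lia.
move: (\sum_i _)%N ('C(k, r) * 'C(r, s))%N N0 G0 => Min G N0 G0.
move=> /(congr1 (GRing.natmul (1 : R))); rewrite !natrM => eN eM_nat.
have eM : k%:R * (2 * Min%:R) + s%:R * ('C(n - h, k)%:R * G%:R)
    = k%:R * ('C(n - h, k)%:R * G%:R) + s%:R * ('C(n, k)%:R * G%:R) :> R.
  by rewrite -!natrM -[LHS]natrD -[RHS]natrD eM_nat.
move: (#|E|%:R : R) (k%:R : R) ('C(n, k)%:R : R) ('C(n - h, k)%:R : R) (s%:R : R)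
  (Min%:R : R) (G%:R : R) N0 G0 k0 C0 eN eM => N K Cn Cm S M g N0 G0 k0 C0 eN eM.
have -> : N = Cn * g / 2 by move: eN; lra.
have -> : M = (K * (Cm * g) + S * (Cn * g) - S * (Cm * g)) / (2 * K).
  by rewrite -eM; field; rewrite gt_eqF.
by field; rewrite !gt_eqF.
Qed.

(** The last part gives the first term. Every other part has a proportion of at most [r / n] of the
    degrees, and these proportions sum to at most 1, so their squares sum to at most [r / n]. *)
Lemma sum_sqr_fibre_degree_johnson :
  \sum_i (wsum (fibre_degree R (@label n r h) i) E / (2 * #|E|%:R)) ^+ 2
  <= ('C(n - h, r)%:R / 'C(n, r)%:R) ^+ 2 + r%:R / n%:R.
Proof.
have N0 := card_johnson_gt0.
have n0 : (0 < n)%N by lia.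
have Cnr : 0 < 'C(n, r)%:R :> R by rewrite ltr0n bin_gt0; lia.
have eN : 2 * #|E|%:R = 'C(n, r)%:R * ('C(r, s) * 'C(n - r, r - s))%N%:R :> R.
  by rewrite -[RHS]natrM -(card_johnson_degree n sr) natrM.
have D0 : 0 < ('C(r, s) * 'C(n - r, r - s))%N%:R :> R.
  by rewrite -(pmulr_rgt0 _ Cnr) -eN mulr_gt0.
rewrite big_option; apply: lerD.
  rewrite /wsum /fibre_degree -natr_sum sum_edges_none // natrM eN.
  by rewrite -mulf_div divff ?mulr1 // gt_eqF.
have b0 i : 0 <= wsum (fibre_degree R (@label n r h) i) E / (2 * #|E|%:R).
  by rewrite divr_ge0 ?fibre_degree_ge0 // mulr_ge0.
have le_rn i : wsum (fibre_degree R (@label n r h) (Some i)) E / (2 * #|E|%:R) <= r%:R / n%:R.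
  have -> : r%:R / n%:R = 'C(n.-1, r.-1)%:R / 'C(n, r)%:R :> R.
    have nz : n%:R != 0 :> R by rewrite pnatr_eq0 -lt0n.
    apply/eqP; rewrite (eqr_div _ _ nz (lt0r_neq0 Cnr)) -!natrM eqr_nat.
    by rewrite [X in _ == X]mulnC mul_bin_diag prednK //; lia.
  have -> : 'C(n.-1, r.-1)%:R / 'C(n, r)%:R =
     ('C(n.-1, r.-1) * ('C(r, s) * 'C(n - r, r - s)))%N%:R / (2 * #|E|%:R) :> R.
    by rewrite eN [in RHS]natrM -mulf_div divff ?mulr1 // gt_eqF.
  rewrite ler_pM2r ?invr_gt0 ?mulr_gt0 //.
  by rewrite /wsum /fibre_degree -natr_sum ler_nat; exact: sum_edges_some.
have S1 := sum_fibre_degree (@label n r h) (card_johnson_edge sr) N0.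
apply: (@le_trans _ _ (\sum_i r%:R / n%:R *
    (wsum (fibre_degree R (@label n r h) (Some i)) E / (2 * #|E|%:R)))).
  by apply: ler_sum => i _; rewrite expr2 ler_wpM2r.
rewrite -mulr_sumr ler_piMr ?divr_ge0 //.
by move: S1 (b0 None); rewrite big_option; lra.
Qed.

End JohnsonRatios.

(** * Limits of ratios of binomial coefficients *)

Section BinomialLimits.
Variable R : realType.
Implicit Types (m : nat -> nat) (y : R).
Local Open Scope classical_set_scope.

Lemma eq_near_cvg (f g : nat -> R) (l : R) : (\forall n \near \oo, f n = g n) ->
  f n @[n --> \oo] --> l -> g n @[n --> \oo] --> l.
Proof. by move=> fg; apply: cvg_trans; exact: near_eq_cvg. Qed.

Lemma cvg_invn : (n%:R^-1 : R) @[n --> \oo] --> (0 : R).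
Proof. by apply/gtr0_cvgV0; [exists 1%N => //= n n0; rewrite ltr0n|exact: cvgr_idn]. Qed.

(** The truncated difference is [m n - minn (m n) i], and the subtracted term is bounded. *)
Lemma cvg_subn_div m y i : (m n)%:R / n%:R @[n --> \oo] --> y ->
  (m n - i)%N%:R / n%:R @[n --> \oo] --> y.
Proof.
move=> my.
have h0 : (minn (m n) i)%:R / n%:R @[n --> \oo] --> (0 : R).
  apply: (@squeeze_cvgr _ _ _ _ (fun=> 0) (fun n => i%:R * n%:R^-1)).
  - apply: nearW => n; rewrite divr_ge0 //= ler_wpM2r ?invr_ge0 //.
    by rewrite ler_nat geq_minr.
  - exact: cvg_cst.
  - rewrite -[X in _ --> X](mulr0 i%:R); apply: cvgM; first exact: cvg_cst.
    exact: cvg_invn.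
rewrite -[y]subr0; apply: eq_near_cvg (cvgB my h0); apply: nearW => n /=.
rewrite -mulrBl; congr (_ / _); apply/eqP; rewrite subr_eq -natrD eqr_nat; lia.
Qed.

(** The factorials of [j] cancel and leave [j] factors [(m n - i) / (n - i)], each tending to
    [y]. *)
Lemma cvg_ratio_bin m y j : (m n)%:R / n%:R @[n --> \oo] --> y ->
  'C(m n, j)%:R / 'C(n, j)%:R @[n --> \oo] --> y ^+ j.
Proof.
move=> my.
have id1 : n%:R / n%:R @[n --> \oo] --> (1 : R).
  apply: eq_near_cvg (cvg_cst (1 : R)).
  by exists 1%N => //= n n0; rewrite divff // pnatr_eq0 -lt0n.
have fac i : (m n - i)%N%:R / (n - i)%N%:R @[n --> \oo] --> y.
  rewrite -[y]divr1.
  apply: (@eq_near_cvg (fun n => (m n - i)%N%:R / n%:R * ((n - i)%N%:R / n%:R)^-1)).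
    exists i.+1 => // n /= ni.
    have n0 : n%:R != 0 :> R by rewrite pnatr_eq0; lia.
    have ni0 : (n - i)%N%:R != 0 :> R by rewrite pnatr_eq0; lia.
    by field; rewrite n0 ni0.
  apply: cvgM; first exact: cvg_subn_div.
  by apply: cvgV; [exact: oner_neq0|exact: cvg_subn_div].
have : \prod_(i < j) ((m n - i)%N%:R / (n - i)%N%:R) @[n --> \oo] --> y ^+ j.
  elim: j => [|j IH].
    by under eq_cvg do rewrite big_ord0; exact: cvg_cst.
  rewrite exprSr; under eq_cvg do rewrite big_ord_recr /=.
  by apply: cvgM.
apply: eq_near_cvg; apply: nearW => n /=.
rewrite prodf_div -!natr_prod -!ffact_prod -!bin_ffact !natrM.
by rewrite -mulf_div divff ?mulr1 // pnatr_eq0 -lt0n fact_gt0.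
Qed.

Lemma cvg_truncn_div y : 0 <= y -> (Num.truncn (y * n%:R))%:R / n%:R @[n --> \oo] --> y.
Proof.
move=> y0; apply: (@squeeze_cvgr _ _ _ _ (fun n => y - n%:R^-1) (fun=> y)).
- exists 1%N => //= n n1.
  have n0 : 0 < n%:R :> R by rewrite ltr0n.
  have /truncn_itv/andP[h1 h2] : 0 <= y * n%:R by rewrite mulr_ge0.
  rewrite ler_pdivrMr // h1 andbT ler_pdivlMr // mulrBl mulVf ?gt_eqF //.
  by rewrite lerBlDr ltW // natr1.
- by rewrite -[X in _ --> X]subr0; apply: cvgB; [exact: cvg_cst|exact: cvg_invn].
- exact: cvg_cst.
Qed.

End BinomialLimits.

Lemma limn_einf_ge (R : realType) (u v : nat -> R) (l : R) :
  (v n @[n --> \oo] --> l)%classic -> (\forall n \near \oo, v n <= u n)%classic ->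
  (l%:E <= limn_einf (EFin \o u))%E.
Proof.
move=> vl vu; apply/lee_subgt0Pr => e e0.
have lt_v : (\forall n \near \oo, l - e < v n)%classic.
  by apply: (cvgr_gt l) => //; rewrite gtrBl.
have [N _ hN] : (\forall n \near \oo, l - e <= u n)%classic.
  by apply: filterS2 lt_v vu => n /ltW; exact: le_trans.
rewrite limn_einf_lim; apply: lime_ge; first exact: is_cvg_einfs.
exists N => //= n Nn; apply: le_ereal_inf_tmp => _ [i /= ni <-].
by rewrite lee_fin; apply: hN; exact: leq_trans ni.
Qed.

Section Asymptotics.
Variables (R : realType) (r s : nat).
Hypotheses (s0 : (0 < s)%N) (sr : (s < r)%N).
Notation k := (r + (r - s))%N.
Local Open Scope classical_set_scope.

Lemma natr_k : k%:R = 2 * r%:R - s%:R :> R.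
Proof. by rewrite natrD natrB 1?ltnW //; ring. Qed.

(** Eventually [p n] is at least [n] to the power [- (r - s) / 2], while the number of edges has
    order [n ^ k]. The total exponent [r + (r - s) / 2] exceeds 2, and quadratic growth makes the
    inverses summable. *)
Lemma expected_edges_ge (p : nat -> R) :
  little_omega p (fun n => n%:R `^ (- ((r%:R - s%:R) / 2))) ->
  \forall n \near \oo,
    (2 * (2 ^ k * k`!))%:R^-1 * n%:R ^+ 2 <= p n * #|johnson n r s|%:R.
Proof.
move=> /cvgryPge/(_ 1) h; near=> n.
have n1 : 1 <= n%:R :> R by rewrite ler1n; near: n; exists 1%N.
have kn : (2 * k <= n)%N by near: n; exists (2 * k)%N.
have n0 : 0 < n%:R :> R by exact: lt_le_trans n1.
have := card_johnson_ge R sr kn; set c := _^-1; set N := #|_|%:R => cN.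
have pn : n%:R `^ (- ((r%:R - s%:R) / 2)) <= p n.
  rewrite -[leLHS]mul1r -ler_pdivlMr ?powR_gt0 //.
  by near: n.
have c0 : 0 <= c by rewrite invr_ge0.
apply: (@le_trans _ _ (n%:R `^ (- ((r%:R - s%:R) / 2)) * N)); last first.
  by rewrite ler_wpM2r.
apply: (@le_trans _ _ (n%:R `^ (- ((r%:R - s%:R) / 2)) * (c * n%:R ^+ k))); last first.
  by rewrite ler_wpM2l // powR_ge0.
rewrite [leRHS]mulrCA; apply: ler_wpM2l => //; rewrite -!powR_mulrn ?ler0n // -powRD; last first.
  by rewrite (gt_eqF n0) implybT.
apply: ler_powR => //; rewrite natr_k.
have r2 : 2 <= r%:R :> R by rewrite ler_nat; lia.
have s1 : s%:R + 1 <= r%:R :> R by rewrite natr1 ler_nat.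
by lra.
Unshelve. all: by end_near. Qed.

Definition split_ratio : R := ((r%:R - s%:R) / r%:R) `^ s%:R^-1.

Let q : R := (r%:R - s%:R) / r%:R.

Let r0 : 0 < r%:R :> R. Proof. by rewrite ltr0n; lia. Qed.

Let rs : s%:R < r%:R :> R. Proof. by rewrite ltr_nat. Qed.

Let sR0 : 0 < s%:R :> R. Proof. by rewrite ltr0n. Qed.

Let q0 : 0 < q. Proof. by rewrite divr_gt0 // subr_gt0. Qed.

Lemma split_ratio_ge0 : 0 <= split_ratio.
Proof. exact: powR_ge0. Qed.

Lemma split_ratio_le1 : split_ratio <= 1.
Proof.
have <- : 1 `^ s%:R^-1 = 1 :> R by rewrite powR1.
apply: ge0_ler_powR; rewrite ?nnegrE ?invr_ge0 //.
- exact: ltW q0.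
- by rewrite ler_pdivrMr // mul1r gerBl.
Qed.

(** For [y = split_ratio] one has [y ^ s = q], so [y ^ k = y ^ (2r) / q]. The coefficient of
    [y ^ (2r)] becomes [2r / k - 1 = s / k]. *)
Lemma split_ratio_value :
  s%:R / k%:R + (1 - s%:R / k%:R) * split_ratio ^+ k - (split_ratio ^+ r) ^+ 2
  = s%:R / (2 * r%:R - s%:R)
    * (1 + ((r%:R - s%:R) / r%:R) `^ (2 * r%:R / s%:R)).
Proof.
have ys : split_ratio ^+ s = q.
  rewrite -powR_mulrn ?split_ratio_ge0 // -powRrM mulVf ?gt_eqF //.
  by rewrite powRr1 // ltW.
have y2r : (split_ratio ^+ r) ^+ 2 = q `^ (2 * r%:R / s%:R).
  rewrite -exprM -powR_mulrn ?split_ratio_ge0 // -powRrM.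
  by congr (_ `^ _); rewrite natrM mulrC [_ * 2]mulrC.
have yk : split_ratio ^+ k = (split_ratio ^+ r) ^+ 2 / q.
  rewrite -ys -exprM; apply: (canRL (mulfK _)); first by rewrite ys gt_eqF.
  by rewrite -exprD; congr (_ ^+ _); lia.
rewrite yk y2r -/q natr_k; move: (q `^ _) => z; rewrite /q.
move: r0 rs sR0; move: (r%:R : R) (s%:R : R) => a b a0 ba b0.
by field; rewrite !gt_eqF // ?subr_gt0; lra.
Qed.

End Asymptotics.

Lemma cvg_modularity_bound (R : realType) (a b t u : nat -> R) (la lb : R) :
  (a n @[n --> \oo] --> la -> b n @[n --> \oo] --> lb ->
  t n @[n --> \oo] --> (0 : R) -> u n @[n --> \oo] --> (1 : R) ->
  modularity_bound (a n) (b n) (t n) (u n) @[n --> \oo] --> la - lb)%classic.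
Proof.
move=> ha hb ht hu; rewrite /modularity_bound.
have -> : la - lb = (la - 0) / 1 - (lb + 0 + 0 ^+ 2) / 1 ^+ 2.
  by rewrite subr0 expr0n expr1n /= !divr1 !addr0.
apply: cvgB; apply: cvgM.
- exact: cvgB.
- by apply: cvgV => //; exact: oner_neq0.
- by apply: cvgD; [exact: cvgD|rewrite expr2; under eq_cvg do rewrite expr2; exact: cvgM].
- apply: cvgV; first by rewrite expr1n oner_neq0.
  by rewrite expr2; under eq_cvg do rewrite expr2; exact: cvgM.
Qed.

(** * The lower limit for a fixed outcome, and the theorem *)

Section JohnsonModularity.
Variables (R : realType) (r s : nat).
Hypotheses (s0 : (0 < s)%N) (sr : (s < r)%N).
Notation k := (r + (r - s))%N.

Definition split_tail n := Num.truncn (split_ratio R r s * n%:R).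
Definition split_label n : johnson_vertex n r -> option 'I_n :=
  @label n r (n - split_tail n).

Lemma split_tail_le n : (split_tail n <= n)%N.
Proof.
rewrite /split_tail -(ler_nat R); have y0 := split_ratio_ge0 R r s.
have /truncn_itv/andP[h _] : 0 <= split_ratio R r s * n%:R by rewrite mulr_ge0.
by rewrite (le_trans h) // ler_piMl // split_ratio_le1.
Qed.

(** The deterministic half of the argument: once the deviations vanish, the lower bound for the
    modularity tends to the value at the optimal [y]. *)
Lemma modularity_limit (p : nat -> R) (S : forall n, {set {set johnson_vertex n r}}) :
  (forall n, S n \subset johnson n r s) ->
  (\forall n \near \oo, 0 < p n * #|johnson n r s|%:R)%classic ->
  (sqr_deviation (split_label (n := n)) (johnson n r s) (S n) (p n)
     @[n --> \oo] --> (0 : R))%classic ->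
  ((s%:R / (2 * r%:R - s%:R)
        * (1 + ((r%:R - s%:R) / r%:R) `^ (2 * r%:R / s%:R)))%:E
     <= limn_einf (fun n => (modularity R (S n))%:E))%E.
Proof.
move=> SE pE D0; set y := split_ratio R r s.
pose D n := sqr_deviation (split_label (n := n)) (johnson n r s) (S n) (p n).
pose t n := Num.sqrt (D n).
pose dev1 n := deviation (johnson n r s) (S n) (p n) (fun=> 1).
have t0 : (t n @[n --> \oo] --> (0 : R))%classic.
  rewrite -sqrtr0; apply: (continuous_cvg _ _ D0); exact: sqrt_continuous.
have u1 : (1 + dev1 n @[n --> \oo] --> (1 : R))%classic.
  rewrite -[X in (_ --> X)%classic](addr0 1); apply: cvgD; first exact: cvg_cst.
  apply: (@squeeze_cvgr _ _ _ _ (fun n => - t n) t) => //; last first.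
    by rewrite -oppr0; apply: cvgN.
  apply: nearW => n; rewrite -ler_norml -sqrtr_sqr ler_wsqrtr // /D /sqr_deviation.
  by rewrite -addrA lerDl addr_ge0 ?sqr_ge0 // sumr_ge0 // => i _; exact: sqr_ge0.
pose ratio j n : R := 'C(split_tail n, j)%:R / 'C(n, j)%:R.
have ratioP j : (ratio j n @[n --> \oo] --> y ^+ j)%classic.
  by apply: cvg_ratio_bin; apply: cvg_truncn_div; exact: split_ratio_ge0.
rewrite -split_ratio_value // -/y.
pose a n : R := s%:R / k%:R + (1 - s%:R / k%:R) * ratio k n.
pose b n : R := ratio r n ^+ 2 + r%:R / n%:R.
apply: (@limn_einf_ge _ _ (fun n => modularity_bound (a n) (b n) (t n) (1 + dev1 n))).
  apply: cvg_modularity_bound => //.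
    apply: cvgD; first exact: cvg_cst.
    by apply: cvgM; [exact: cvg_cst|exact: ratioP].
  rewrite -[X in (_ --> X)%classic]addr0; apply: cvgD.
    rewrite [X in (_ --> X)%classic]expr2; under eq_cvg do rewrite expr2.
    by apply: cvgM; exact: ratioP.
  rewrite -[X in (_ --> X)%classic](mulr0 r%:R); apply: cvgM; first exact: cvg_cst.
  exact: cvg_invn.
near=> n.
have kn : (k <= n)%N by near: n; exists k.
have pEn : 0 < p n * #|johnson n r s|%:R by near: n.
have hn : (n - split_tail n <= n)%N by exact: leq_subr.
apply: le_trans (modularity_ge_deviation (split_label (n := n)) (SE n)
  (card_johnson_edge sr) pEn).
rewrite wsum_inner_part_johnson // (subKn (split_tail_le n)) /modularity_bound.
(* The bound decreases in its second argument, so the upper estimate of the squared degrees may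
   replace their exact sum. *)
apply: lerB => //; apply: ler_wpM2r; first by rewrite invr_ge0 sqr_ge0.
rewrite !lerD2r; have := sum_sqr_fibre_degree_johnson R s0 sr hn kn.
by rewrite (subKn (split_tail_le n)).
Unshelve. all: by end_near. Qed.

End JohnsonModularity.

Theorem theorem3p13 (R : realType) (d : measure_display)
  (T : measurableType d) (P : probability T R)
  (r s : nat) (p : nat -> R)
  (H : forall n : nat, T -> {set {set johnson_vertex n r}}) :
  (1 <= s < r)%N ->
  (forall n, 0 <= p n <= 1) ->
  little_omega p (fun n => n%:R `^ (- ((r%:R - s%:R) / 2))) ->
  (forall n, random_subgraph P (johnson n r s) (p n) (H n)) ->
  {ae P, forall w,
    ((s%:R / (2 * r%:R - s%:R)
        * (1 + ((r%:R - s%:R) / r%:R) `^ (2 * r%:R / s%:R)))%:E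
     <= limn_einf (fun n => (modularity R (H n w))%:E))%E}.
Proof.
move=> /andP[s0 sr] p01 pw rsH.
have [N _ hN] := expected_edges_ge s0 sr pw.
set c := _^-1 in hN.
have c0 : 0 < c by rewrite invr_gt0 ltr0n !muln_gt0 expn_gt0 fact_gt0.
pose D n w := sqr_deviation (split_label R s (n := n)) (johnson n r s) (H n w) (p n).
have [m Dm] := @choice _ _ (fun n x => has_mean P (D n) x /\
    x <= 9 / (p n * #|johnson n r s|%:R)) (fun n =>
  let: ex_intro2 x xm xle := has_mean_sqr_deviation_le (split_label R s (n := n))
    (rsH n) (card_johnson_edge sr) (p01 n) in ex_intro _ x (conj xm xle)).
have D_ge0 n w : 0 <= D n w.
  by rewrite !addr_ge0 ?sqr_ge0 // sumr_ge0 // => i _; exact: sqr_ge0.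
(* Shifting by [N.+2] passes the threshold [N] and gives [(n + M) ^ 2 >= (n + 1) * (n + 2)], the
   comparison with the telescoping majorant. *)
pose M := N.+2.
have pE n : (M <= n)%N -> 0 < p n * #|johnson n r s|%:R.
  move=> Mn; apply: lt_le_trans (hN n _); last by rewrite /=; lia.
  by rewrite mulr_gt0 // exprn_gt0 // ltr0n; lia.
have mle n : m (n + M)%N <= 9 / c * (n.+1%:R * n.+2%:R)^-1.
  have Mn : (M <= n + M)%N by exact: leq_addl.
  apply: le_trans (Dm _).2 _; rewrite -mulrA -invfM ler_wpM2l // lef_pV2 ?posrE.
  - apply: le_trans (hN (n + M)%N _); last by rewrite /=; lia.
    apply: ler_wpM2l; [exact: ltW|].
    by rewrite expr2 -!natrM ler_nat; apply: leq_mul; lia.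
  - exact: pE.
  - by rewrite !mulr_gt0.
apply: filterS (summable_means_cvg0 (fun n => D_ge0 (n + M)%N)
  (fun n => (Dm (n + M)%N).1) mle) => w.
(* The shift does not affect the limit. *)
rewrite (cvg_shiftn M (D ^~ w)) => Dw.
apply: (@modularity_limit _ _ _ s0 sr p (fun n => H n w)) => //.
- by move=> n; have [sub _ _] := rsH n; exact: sub.
- by exists M => //= n; exact: pE.
Qed.
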